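(* Let $\Theta$ be a simplicial theory. Then $\Theta$ admits of entangled states if and only if $\Theta$ does not satisfy local discriminability.
   Context: **Operational probabilistic theories (OPTs).** An OPT $\Theta$ consists of a class $\mathsf{Sys}(\Theta)$ of systems $A,B,\dots$ with a trivial system $I$ and an associative composition $(A,B)\mapsto AB$ with unit $I$ (systems may be reordered by deterministic swaps), and, for each pair $A,B$, a collection of tests $\{E_x\}_{x\in X}$ ($X$ a finite outcome set) made of events $E_x$ from $A$ to $B$; every event belongs to some test. Tests can be composed sequentially ($\circ$) and in parallel ($\boxtimes$), with identity events and the law $(\mathcal A\boxtimes\mathcal B)\circ(\mathcal C\boxtimes\mathcal D)=(\mathcal A\circ\mathcal C)\boxtimes(\mathcal B\circ\mathcal D)$ (a strict symmetric monoidal structure). Events from $I$ to $I$ are probabilities in $[0,1]$, composed by multiplication, and every test from $I$ to $I$ is a probability distribution. For a test $\{E_x\}_{x\in X}$ and $Y\subseteq X$ the coarse-graining $\sum_{y\in Y}E_y$ is an event (merging outcomes of a test gives a test), and both compositions distribute over sums. Events giving the same probabilities in all contexts are identified. States $\rho\in\mathsf{St}(A)$ are (classes of) events from $I$ to $A$; effects $a\in\mathsf{Eff}(A)$ are (classes of) events from $A$ to $I$; $(a|\rho)\in[0,1]$ is the resulting probability. Effects separate states and states separate effects, so $\mathsf{St}(A)$ is a subset of the real vector space $\mathsf{St}_{\mathbb R}(A)=\mathrm{span}_{\mathbb R}\,\mathsf{St}(A)$ and effects are linear functionals on it; sums of events are vector sums. $D_A=\dim\mathsf{St}_{\mathbb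 R}(A)$ is assumed finite for all $A$. The null state $\varepsilon=0$ always belongs to $\mathsf{St}(A)$. An event is deterministic if it forms a test with a single outcome (so the full coarse-graining of a test is deterministic); compositions of deterministic events are deterministic; a state is deterministic iff every deterministic effect takes value $1$ on it. Every system has at least one preparation test (input $I$) and one observation test (output $I$). $\mathsf{St}(A)$ need not be convex. For states $\alpha\in\mathsf{St}(A)$, $\beta\in\mathsf{St}(B)$ the product state $\alpha\boxtimes\beta\in\mathsf{St}(AB)$ is written $\alpha\beta$; similarly for effects. **Simplicial theory.** $\mathsf{ExtSt}(A)$ is the set of extreme points of the convex hull $\mathrm{Conv}(\mathsf{St}(A))$ (including the null state $0$). An OPT is simplicial if for every system $A$ the elements of $\mathsf{ExtSt}(A)$ are the vertices of a $D_A$-simplex, i.e. there are exactly $D_A+1$ of them, they are affinely independent, and their convex hull is $\mathrm{Conv}(\mathsf{St}(A))$. **Local discriminability.** For every $m\ge 1$ and every $m$-partite system $S_1\cdots S_m$, the (conic combinations of) product effects $a_1\boxtimes\cdots\boxtimes a_m$ with $a_i\in\mathsf{Eff}(S_i)$ separate the states of $S_1\cdots S_m$. **Entangled states.** A state of a bipartite system $AB$ is separable if it is of the form $\sum_{i\in J}p_i\,\alpha_i\beta_i$ with $J$ finite (possibly empty), $p_i>0$, and non-null $\alpha_i\in\mathsf{St}(A)$, $\beta_i\in\mathsf{St}(B)$. A state of $AB$ is entangled if it is not separable. $\Theta$ admits of entangled states if for some systems $A,B$ there is an entangled state of $AB$.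
   Formalization: Local discriminability is taken to mean that product effects separate all points of the convex hull of the states (probabilistic mixtures), not just the states; for non-convex state sets the literal version fails, and for convex ones the two agree. *)

(* Defs.v *)
From HB Require Import structures.
From mathcomp Require Import all_boot all_order all_algebra.
From mathcomp Require Import all_classical all_reals.

Set Implicit Arguments.
Unset Strict Implicit.
Unset Printing Implicit Defensive.

Import Order.TTheory GRing.Theory Num.Theory.

Local Open Scope classical_set_scope.
Local Open Scope ring_scope.

Section RealVectorSpaces.
Context {R : realType} {V : lmodType R}.
Implicit Types S C : set V.

Definition linspan S : set V :=
  [set v | exists n (x : 'I_n -> V) (c : 'I_n -> R),
     (forall i, S (x i)) /\ v = \sum_i c i *: x i].

Definition lin_indep n (x : 'I_n -> V) : Prop :=
  forall c : 'I_n -> R, \sum_i c i *: x i = 0 -> forall i, c i = 0.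

Definition aff_indep n (x : 'I_n -> V) : Prop :=
  forall c : 'I_n -> R, \sum_i c i = 0 -> \sum_i c i *: x i = 0 ->
  forall i, c i = 0.

(* S has a basis with n elements; meant for linear subspaces S. *)
Definition has_dim S (n : nat) : Prop :=
  exists x : 'I_n -> V, lin_indep x /\ linspan (range x) = S.

(* The value is 0 by convention when S is not finite-dimensional. *)
Definition dimension S : nat := xget 0%N [set n | has_dim S n].

Definition conv_hull S : set V :=
  [set v | exists n (x : 'I_n -> V) (p : 'I_n -> R),
     [/\ forall i, S (x i), forall i, 0 <= p i, \sum_i p i = 1
       & v = \sum_i p i *: x i]].

Definition extreme_points C : set V :=
  [set v | C v /\ forall (x y : V) (t : R), C x -> C y -> 0 < t < 1 ->
     v = t *: x + (1 - t) *: y -> x = v /\ y = v].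

End RealVectorSpaces.

(* Transport of an arrow along equalities of its source and target; it is
   needed to state strict associativity and unitality. *)
Definition cast_arrow (S : Type) (H : S -> S -> Type) (A A' B B' : S)
    (eA : A = A') (eB : B = B') (f : H A B) : H A' B' :=
  match eA in _ = a, eB in _ = b return H a b with
  | erefl, erefl => f
  end.

(* comp f g is f after g. *)
Record strict_smc : Type := StrictSMC {
  sys : Type;
  event : sys -> sys -> Type;
  triv : sys;
  tens : sys -> sys -> sys;
  tensA : forall A B C, tens A (tens B C) = tens (tens A B) C;
  tens1s : forall A, tens triv A = A;
  tenss1 : forall A, tens A triv = A;
  idev : forall A, event A A;
  comp : forall A B C, event B C -> event A B -> event A C;
  par : forall A B C D,
    event A B -> event C D -> event (tens A C) (tens B D);
  swap : forall A B, event (tens A B) (tens B A);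
  comp1e : forall A B (f : event A B), comp (idev B) f = f;
  compe1 : forall A B (f : event A B), comp f (idev A) = f;
  compA : forall A B C D (f : event C D) (g : event B C) (h : event A B),
    comp f (comp g h) = comp (comp f g) h;
  par_id : forall A B, par (idev A) (idev B) = idev (tens A B);
  interchange : forall A B C A' B' C' (f : event B C) (f' : event B' C')
      (g : event A B) (g' : event A' B'),
    comp (par f f') (par g g') = par (comp f g) (comp f' g');
  parA : forall A B C A' B' C'
      (f : event A A') (g : event B B') (h : event C C'),
    cast_arrow (tensA A B C) (tensA A' B' C') (par f (par g h)) =
    par (par f g) h;
  par1e : forall A B (f : event A B),
    cast_arrow (tens1s A) (tens1s B) (par (idev triv) f) = f;
  pare1 : forall A B (f : event A B),
    cast_arrow (tenss1 A) (tenss1 B) (par f (idev triv)) = f;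
  swap_natural : forall A B C D (f : event A B) (g : event C D),
    comp (swap B D) (par f g) = comp (par g f) (swap A C);
  swapK : forall A B, comp (swap B A) (swap A B) = idev (tens A B);
  swap_hexagon : forall A B C,
    cast_arrow (tensA A B C) (esym (tensA B C A)) (swap A (tens B C)) =
    comp (par (idev B) (swap A C))
         (cast_arrow (erefl _) (esym (tensA B A C))
                     (par (swap A B) (idev C)))
}.

Arguments triv {_}.
Arguments tens {_} _ _.
Arguments idev {_} _.
Arguments swap {_} _ _.

Local Notation "A ** B" := (tens A B) (at level 40, left associativity).
Local Notation "f \co g" := (comp f g) (at level 50, left associativity).
Local Notation "f \ot g" := (par f g) (at level 45, left associativity).

(* A test is a family of events indexed by its finite outcome set, and coarse
   E Y is the sum of the E y over y in Y; coarse is total, but constrained only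
   when E is a test.  An event is deterministic when it is a test with outcome
   set unit. *)
Record opt_structure (R : realType) : Type := OptStructure {
  smc :> strict_smc;
  test : forall (A B : sys smc) (X : finType), (X -> event A B) -> Prop;
  coarse : forall (A B : sys smc) (X : finType),
    (X -> event A B) -> {set X} -> event A B;
  prob : event (@triv smc) triv -> R;

  prob_ge0 : forall s, 0 <= prob s;
  prob_le1 : forall s, prob s <= 1;
  prob_inj : injective prob;
  prob_comp : forall s t, prob (s \co t) = prob s * prob t;
  prob_par : forall s t,
    prob (cast_arrow (tens1s triv) (tens1s triv) (s \ot t)) = prob s * prob t;
  prob_test : forall (X : finType) (p : X -> event triv triv),
    test p -> \sum_x prob (p x) = 1;

  event_test : forall (A B : sys smc) (f : event A B),
    exists (X : finType) (E : X -> event A B) (x : X), test E /\ E x = f;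
  test_id : forall A : sys smc, test (fun _ : unit => idev A);
  test_swap : forall A B : sys smc, test (fun _ : unit => swap A B);
  test_comp : forall (A B C : sys smc) (X Z : finType)
      (E : X -> event A B) (F : Z -> event B C),
    test E -> test F -> test (fun k : X * Z => F k.2 \co E k.1);
  test_par : forall (A B C D : sys smc) (X Z : finType)
      (E : X -> event A B) (F : Z -> event C D),
    test E -> test F -> test (fun k : X * Z => E k.1 \ot F k.2);
  prep_test : forall A : sys smc,
    exists (X : finType) (E : X -> event triv A), test E;
  obs_test : forall A : sys smc,
    exists (X : finType) (E : X -> event A triv), test E;

  test_merge : forall (A B : sys smc) (X Z : finType) (E : X -> event A B)
      (f : X -> Z), test E -> (forall z, exists x, f x = z) ->
    test (fun z => coarse E (finset (fun x => f x == z)));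
  coarse1 : forall (A B : sys smc) (X : finType) (E : X -> event A B) (x : X),
    test E -> coarse E (finset.set1 x) = E x;
  coarse_comp : forall (A B C : sys smc) (X Z : finType)
      (E : X -> event A B) (F : Z -> event B C) (Y : {set X}) (W : {set Z}),
    test E -> test F ->
    coarse F W \co coarse E Y =
    coarse (fun k : X * Z => F k.2 \co E k.1) (finset.setX Y W);
  coarse_par : forall (A B C D : sys smc) (X Z : finType)
      (E : X -> event A B) (F : Z -> event C D) (Y : {set X}) (W : {set Z}),
    test E -> test F ->
    coarse E Y \ot coarse F W =
    coarse (fun k : X * Z => E k.1 \ot F k.2) (finset.setX Y W);
  coarse_prob : forall (X : finType) (p : X -> event triv triv) (Y : {set X}),
    test p -> prob (coarse p Y) = \sum_(x in Y) prob (p x);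

  (* Events are taken modulo equality of probabilities in all contexts; thanks
     to swaps it is enough to place the ancilla on the right. *)
  event_sep : forall (A B : sys smc) (f g : event A B),
    (forall (C : sys smc) (r : event triv (A ** C)) (a : event (B ** C) triv),
       prob (a \co ((f \ot idev C) \co r)) =
       prob (a \co ((g \ot idev C) \co r))) ->
    f = g
}.

Section States.
Context {R : realType} (Th : opt_structure R).
Implicit Types A B : sys Th.

Definition state A : Type := event triv A.
Definition effect A : Type := event A triv.

Definition prod_state A B (r : state A) (s : state B) : state (A ** B) :=
  cast_arrow (tens1s triv) (erefl (A ** B)) (r \ot s).

Definition prod_effect A B (a : effect A) (b : effect B) : effect (A ** B) :=
  cast_arrow (erefl (A ** B)) (tens1s triv) (a \ot b).

(* A state is represented by its probabilities on effects (faithfully, by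
   event_sep), so the ambient real vector space is the space of functions on
   effects; an effect a acts on a vector v as the linear functional v a. *)
Definition vec A (r : state A) : effect A -> R^o :=
  fun a => prob (a \co r).

Definition St A : set (effect A -> R^o) := range (@vec A).
Arguments St A _ : clear implicits.
Definition StR A : set (effect A -> R^o) := linspan (St A).
Arguments StR A _ : clear implicits.
Definition ConvSt A : set (effect A -> R^o) := conv_hull (St A).
Arguments ConvSt A _ : clear implicits.
Definition ExtSt A : set (effect A -> R^o) := extreme_points (ConvSt A).
Arguments ExtSt A _ : clear implicits.

Definition dimSt A : nat := dimension (StR A).

(* affine independence makes the x i pairwise distinct, so there are exactly
   dimSt A + 1 of them *)
Definition simplicial : Prop := forall A,
  exists x : 'I_(dimSt A).+1 -> (effect A -> R^o),
    [/\ range x = ExtSt A, aff_indep x & conv_hull (range x) = ConvSt A].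

Fixpoint multipartite A (s : seq (sys Th)) : sys Th :=
  if s is B :: s' then A ** multipartite B s' else A.

Fixpoint product_effects A (s : seq (sys Th)) :
    set (effect (multipartite A s)) :=
  match s return set (effect (multipartite A s)) with
  | [::] => setT
  | B :: s' => [set e | exists (a : effect A)
                          (b : effect (multipartite B s')),
                  product_effects b /\ e = prod_effect a b]
  end.

(* Product effects must separate states and their probabilistic mixtures
   (ConvSt), equivalently all vectors of StR: St need not be convex, and
   separating only its points would not force the product effects to span all
   linear functionals on StR. *)
Definition local_discriminability : Prop :=
  forall A (s : seq (sys Th)) (x y : effect (multipartite A s) -> R^o),
    ConvSt (multipartite A s) x -> ConvSt (multipartite A s) y ->
    (forall n (e : 'I_n -> effect (multipartite A s)) (c : 'I_n -> R),
       (forall k, product_effects (e k)) -> (forall k, 0 <= c k) ->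
       \sum_k c k * x (e k) = \sum_k c k * y (e k)) ->
    x = y.

Definition separable A B (r : state (A ** B)) : Prop :=
  exists n (p : 'I_n -> R) (a : 'I_n -> state A) (b : 'I_n -> state B),
    [/\ forall i, 0 < p i,
        forall i, vec (a i) <> 0,
        forall i, vec (b i) <> 0
      & vec r = \sum_i p i *: vec (prod_state (a i) (b i))].

Definition entangled A B (r : state (A ** B)) : Prop := ~ separable r.

Definition admits_entangled_states : Prop :=
  exists (A B : sys Th) (r : state (A ** B)), entangled r.

End States.

Arguments St {R Th} A _.
Arguments StR {R Th} A _.
Arguments ConvSt {R Th} A _.
Arguments ExtSt {R Th} A _.

Record opt (R : realType) : Type := Opt {
  opt_struct :> opt_structure R;
  opt_fin_dim : forall A : sys opt_struct, exists n, has_dim (StR A) n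
}.

(* Main.v *)
From Pilot Require Import Defs.
From mathcomp Require Import all_boot all_order all_algebra.
From mathcomp Require Import all_classical all_reals.

(* In a simplicial theory the non-null vertices of the states of a system form a
   basis such that every state is a nonnegative combination of it.

   Assume local discriminability, and let x i, y j, z h be these bases for A, B
   and AB.  Decompose x i * y j over the z h.  Contracting with an effect on one
   side shows that each z h occurring there agrees, up to a scalar, with
   x i * y j on product effects, hence is proportional to it.  Since functionals
   dual to the x i are linear combinations of effects, the x i * y j span all
   states of AB, so every z h occurring in a state r does occur in some
   x i * y j.  Thus r is a positive combination of products.

   Conversely, if all states are separable, the products of basis vectors span
   the states of a composite, and the linear independence of the two bases lets
   product effects detect every coefficient, one factor at a time. *)

Set Implicit Arguments.
Unset Strict Implicit.
Unset Printing Implicit Defensive.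

Import Order.TTheory GRing.Theory Num.Theory.
Import Pilot.Defs.

Local Open Scope classical_set_scope.
Local Open Scope ring_scope.

(** * Linear independence and dual families in spaces of real functions *)

Section FunctionSpaces.
Context {R : realType} {T : Type}.
Implicit Types f : T -> R^o.

Lemma sum_scaleE (I : finType) (c : I -> R) (f : I -> T -> R^o) t :
  (\sum_i c i *: f i) t = \sum_i c i * f i t.
Proof. by rewrite fct_sumE. Qed.

Lemma lin_indepP n (f : 'I_n -> T -> R^o) :
  lin_indep f <-> forall c : 'I_n -> R,
    (forall t, \sum_i c i * f i t = 0) -> forall i, c i = 0.
Proof.
split=> h c hc; apply: h.
- by apply/funext => t; rewrite sum_scaleE hc.
- by move=> t; rewrite -sum_scaleE hc.
Qed.

Lemma lin_indep_eq n (f : 'I_n -> T -> R^o) (c d : 'I_n -> R) :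
  lin_indep f -> (forall t, \sum_i c i * f i t = \sum_i d i * f i t) ->
  forall i, c i = d i.
Proof.
move=> /lin_indepP h e i; apply/eqP; rewrite -subr_eq0; apply/eqP.
apply: (h (fun i => c i - d i)) => t.
by under eq_bigr do rewrite mulrBl; rewrite sumrB e subrr.
Qed.

Lemma lin_indep_neq0 n (f : 'I_n -> T -> R^o) i :
  lin_indep f -> exists t, f i t != 0.
Proof.
move=> fI; apply: contrapT => no.
have f0 t : f i t = 0 by apply: contrapT => /eqP ne; apply: no; exists t.
have /(lin_indep_eq fI)/(_ i)/eqP :
    forall t, \sum_j (j == i)%:R * f j t = \sum_j 0 * f j t.
  move=> t; rewrite [RHS]big1 => [|j _]; last by rewrite mul0r.
  rewrite big1 // => j _.
  by have [->|_] := eqVneq j i; rewrite ?f0 (mulr0, mul0r).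
by rewrite eqxx oner_eq0.
Qed.

(** Points are added one at a time. While k < n, a nonzero column of the cokernel is a nontrivial
    combination of the [f i] vanishing at all points chosen so far; independence gives a point where
    it does not vanish, whose row lies outside the row space. *)
Lemma lin_indep_points n (f : 'I_n -> T -> R^o) k : lin_indep f -> (k <= n)%N ->
  exists t : 'I_k -> T, row_free (\matrix_(h, i) f i (t h) : 'M[R]_(k, n)).
Proof.
move=> /lin_indepP fI; elim: k => [|k IH] lekn.
  have t0 : 'I_0 -> T by case.
  by exists t0; rewrite /row_free flatmx0 mxrank0.
have [t tfree] := IH (ltnW lekn); set M := (\matrix_(h, i) _) in tfree.
have [i [j ij]] : exists i j, cokermx M i j != 0.
  apply: contrapT => no; have : \rank (cokermx M) == 0%N.
    rewrite mxrank_eq0; apply/eqP/matrixP => i j; rewrite [RHS]mxE.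
    by apply: contrapT => /eqP ne; apply: no; exists i, j.
  by rewrite mxrank_coker (eqP tfree) subn_eq0 leqNgt lekn.
have [t1 ft1] : exists t1, \sum_i cokermx M i j * f i t1 != 0.
  apply: contrapT => no; move/eqP: ij; apply.
  apply: (fI (fun i => cokermx M i j)) => t1.
  by apply: contrapT => /eqP ne; apply: no; exists t1.
pose v : 'rV[R]_n := \row_i f i t1.
have vM : ~~ (v <= M)%MS.
  rewrite submxE; apply: contra ft1 => /eqP/matrixP/(_ 0 j).
  rewrite [LHS]mxE [RHS]mxE => e; apply/eqP; rewrite -[RHS]e.
  by apply: eq_bigr => h _; rewrite [v _ _]mxE mulrC.
exists (fun h => if unlift ord0 h is Some h' then t h' else t1).
set N := (\matrix_(h, i) _); clear i ij.
have sMN : (col_mx v M <= N)%MS.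
  apply/row_subP => h.
  suff -> : row h (col_mx v M) = row (h : 'I_k.+1) N by apply: row_sub.
  apply/rowP => i; rewrite !mxE; case: splitP => h0 hE; rewrite mxE.
    have -> : h = ord0 :> 'I_k.+1 by apply/val_inj; rewrite /= hE ord1.
    by rewrite unlift_none.
  have -> : h = lift ord0 h0 :> 'I_k.+1 by apply/val_inj.
  by rewrite liftK.
rewrite /row_free eqn_leq rank_leq_row /=.
apply: leq_trans (mxrankS sMN).
have sM : (M < col_mx v M)%MS.
  by rewrite ltmxE col_mx_sub negb_and vM -addsmxE addsmxSr.
by have := rank_ltmx sM; rewrite (eqP tfree).
Qed.

Lemma lin_indep_dual n (f : 'I_n -> T -> R^o) : lin_indep f ->
  exists (t : 'I_n -> T) (d : 'M[R]_n),
    forall i j, \sum_h d i h * f j (t h) = (i == j)%:R.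
Proof.
move=> /lin_indep_points/(_ (leqnn n))[t]; rewrite row_free_unit => tU.
exists t, (invmx (\matrix_(h, i) f i (t h))) => i j.
have /matrixP/(_ i j) := mulVmx tU; rewrite !mxE => <-.
by apply: eq_bigr => h _; rewrite !mxE.
Qed.

(* The f l generate a simplicial cone, so f i spans an extreme ray of it. *)
Lemma lin_indep_ray n k (f : 'I_n -> T -> R^o) (g : 'I_k -> T -> R^o)
    (u : 'I_k -> 'I_n -> R) (P : 'I_k -> R) (z : R) i :
  lin_indep f -> (forall h t, g h t = \sum_l u h l * f l t) ->
  (forall h l, 0 <= u h l) -> (forall h, 0 <= P h) ->
  (forall t, \sum_h P h * g h t = z * f i t) ->
  forall h, 0 < P h -> forall t, g h t = u h i * f i t.
Proof.
move=> fI gE u0 P0 e h Ph t; rewrite gE (bigD1 i) //= big1 ?addr0 // => l li.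
(* Compare coordinates at [l], different from [i]: a sum of nonnegative terms equals 0, so [u h l]
   vanishes when [P h] is positive. *)
have /(lin_indep_eq fI)/(_ l)/eqP : forall t',
    \sum_l (\sum_h P h * u h l) * f l t' = \sum_l (z * (l == i)%:R) * f l t'.
  move=> t'; rewrite [RHS](bigD1 i) //= [X in _ = _ + X]big1; last first.
    by move=> j /negbTE->; rewrite mulr0 mul0r.
  rewrite eqxx mulr1 addr0 -e.
  under eq_bigr do rewrite mulr_suml.
  rewrite exchange_big; apply: eq_bigr => j _ /=.
  by rewrite gE mulr_sumr; apply: eq_bigr => m _; rewrite mulrA.
rewrite (negbTE li) mulr0 psumr_eq0 => [|j _]; last by rewrite mulr_ge0.
move=> /allP/(_ h); rewrite mem_index_enum mulf_eq0 (gt_eqF Ph) /=.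
by move=> /(_ isT)/eqP ->; rewrite mul0r.
Qed.
End FunctionSpaces.

(** * Product states and effects, and contraction of one factor *)

Lemma cast_arrow_irr (S : Type) (H : S -> S -> Type) (A A' B B' : S)
    (eA eA' : A = A') (eB eB' : B = B') (f : H A B) :
  cast_arrow eA eB f = cast_arrow eA' eB' f.
Proof. by rewrite (Prop_irrelevance eA eA') (Prop_irrelevance eB eB'). Qed.

Local Notation "A ** B" := (tens A B) (at level 40, left associativity).
Local Notation "f \co g" := (comp f g) (at level 50, left associativity).
Local Notation "f \ot g" := (par f g) (at level 45, left associativity).

Lemma cast_arrow_comp (T : strict_smc) (A A' B B' C C' : sys T)
    (eA : A = A') (eB : B = B') (eC : C = C') (f : event B C) (g : event A B) :
  cast_arrow eA eC (f \co g) = cast_arrow eB eC f \co cast_arrow eA eB g.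
Proof. by case: _ / eA; case: _ / eB; case: _ / eC. Qed.

Section ProductsAndContractions.
Context {R : realType} {Th : opt_structure R}.
Implicit Types A B : sys Th.

(** The unnormalised conditional state of [B] once [a] is observed on [A]. *)
Definition contract_left A B (a : effect A) (r : state (A ** B)) : state B :=
  cast_arrow (erefl _) (tens1s B) (a \ot idev B) \co r.

Definition contract_right A B (b : effect B) (r : state (A ** B)) : state A :=
  cast_arrow (erefl _) (tenss1 A) (idev A \ot b) \co r.

Definition insert_left A B (r : state A) (e : effect (A ** B)) : effect B :=
  e \co cast_arrow (tens1s B) (erefl _) (r \ot idev B).

Definition insert_right A B (s : state B) (e : effect (A ** B)) : effect A :=
  e \co cast_arrow (tenss1 A) (erefl _) (idev A \ot s).

Lemma vec_contract_left A B (a : effect A) (b : effect B) (r : state (A ** B)) :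
  vec (contract_left a r) b = vec r (prod_effect a b).
Proof.
rewrite /vec /contract_left compA; congr (prob (_ \co _)).
rewrite -[b in LHS]par1e -(cast_arrow_comp (erefl _) (tens1s B)) interchange.
by rewrite comp1e compe1.
Qed.

Lemma vec_contract_right A B (a : effect A) (b : effect B)
    (r : state (A ** B)) :
  vec (contract_right b r) a = vec r (prod_effect a b).
Proof.
rewrite /vec /contract_right compA; congr (prob (_ \co _)).
rewrite -[a in LHS]pare1 -(cast_arrow_comp (erefl _) (tenss1 A)) interchange.
(* [prod_effect] casts along [tens1s triv] and [pare1] along [tenss1 triv]: two proofs of the same
   equation. *)
by rewrite comp1e compe1; apply: cast_arrow_irr.
Qed.

Lemma vec_insert_left A B (e : effect (A ** B)) (r : state A) (s : state B) :
  vec s (insert_left r e) = vec (prod_state r s) e.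
Proof.
rewrite /vec /insert_left -compA; congr (prob (_ \co _)).
rewrite -[s in LHS]par1e -(cast_arrow_comp (tens1s triv) (tens1s B)).
by rewrite interchange comp1e compe1.
Qed.

Lemma vec_insert_right A B (e : effect (A ** B)) (r : state A) (s : state B) :
  vec r (insert_right s e) = vec (prod_state r s) e.
Proof.
rewrite /vec /insert_right -compA; congr (prob (_ \co _)).
rewrite -[r in LHS]pare1 -(cast_arrow_comp (tenss1 triv) (tenss1 A)).
by rewrite interchange comp1e compe1; apply: cast_arrow_irr.
Qed.

Lemma vec_prod_state A B (a : effect A) (b : effect B) r s :
  vec (prod_state r s) (prod_effect a b) = vec r a * vec s b.
Proof.
rewrite -prob_par /vec /prod_effect /prod_state.
by rewrite -(cast_arrow_comp _ (erefl _)) interchange.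
Qed.

(** The empty coarse-graining of a preparation test pairs with every effect to an empty sum. *)
Lemma vec_null A : exists r : state A, vec r = 0.
Proof.
have [X [E tE]] := prep_test A; exists (coarse E finset.set0).
apply/funext => a; have [Z [F [z [tF <-]]]] := event_test a.
rewrite /vec -(coarse1 z tF) coarse_comp // coarse_prob ?big1 //.
  by move=> [x z']; rewrite !inE.
exact: test_comp.
Qed.

End ProductsAndContractions.

(** * Extreme points and bases of the cones of states *)

Lemma extreme_conv_hull (R : realType) (V : lmodType R) (S : set V) :
  extreme_points (conv_hull S) `<=` S.
Proof.
move=> v [[n [x [p [Sx p0 p1 vE]]]] vext].
have [i pi0] : exists i, p i != 0.
  apply: contrapT => no; have /eqP := p1; rewrite big1 => [|i _].
    by rewrite eq_sym oner_eq0.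
  by apply: contrapT => /eqP ne; apply: no; exists i.
have pi_gt0 : 0 < p i by rewrite lt_neqAle eq_sym pi0 p0.
have pD : p i + \sum_(j | j != i) p j = 1 by rewrite -p1 [RHS](bigD1 i).
have vD : v = p i *: x i + \sum_(j | j != i) p j *: x j.
  by rewrite vE (bigD1 i).
have sp0 : 0 <= \sum_(j | j != i) p j by apply: sumr_ge0.
have [pi1|pi1] := eqVneq (p i) 1.
  have : \sum_(j | j != i) p j == 0.
    by rewrite -(inj_eq (addrI 1)) -{1}pi1 pD addr0.
  rewrite psumr_eq0 //.
  move=> /allP p_eq0; suff -> : v = x i by [].
  rewrite vD pi1 scale1r big1 ?addr0 // => j ji.
  have := p_eq0 j; rewrite mem_index_enum ji => /(_ isT)/eqP ->.
  by rewrite scale0r.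
have pD' : \sum_(j | j != i) p j = 1 - p i by rewrite -pD addrAC subrr add0r.
have q0 : 0 < 1 - p i.
  by rewrite -pD' lt_neqAle sp0 pD' eq_sym subr_eq0 eq_sym pi1.
have Cxi : conv_hull S (x i).
  exists 1%N, (fun=> x i), (fun=> 1); split => //;
    by rewrite ?big_ord1 ?scale1r.
(* The other weights renormalised to total 1: [v] lies strictly between [x i] and their mixture, so
   extremality forces [x i = v]. *)
pose q j := if j == i then 0 else p j / (1 - p i).
suff [<- _] : x i = v /\ \sum_j q j *: x j = v by exact: Sx.
apply: (vext _ _ (p i)) => //.
- exists n, x, q; split => //.
    by move=> j; rewrite /q; case: ifP => // _; rewrite divr_ge0 // ltW.
  rewrite (bigD1 i) //= {1}/q eqxx add0r.
  rewrite (eq_bigr (fun j => p j / (1 - p i))) => [|j /negbTE ji]; last first.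
    by rewrite /q ji.
  by rewrite -mulr_suml pD' divff // gt_eqF.
- by rewrite pi_gt0 -subr_gt0.
- rewrite vD [X in _ = _ + _ *: X](bigD1 i) //=.
  rewrite {1}/q eqxx scale0r add0r scaler_sumr.
  congr (_ + _); apply: eq_bigr => j /negbTE ji.
  by rewrite /q ji scalerA mulrCA divff ?mulr1 // gt_eqF.
Qed.

Section ConeBases.
Context {R : realType} {Th : opt_structure R}.
Implicit Types A B : sys Th.

(** The states generate a simplicial cone whose extreme rays are spanned by the [vec (s i)]. *)
Definition cone_basis A n (s : 'I_n -> state A) : Prop :=
  lin_indep (fun i => vec (s i)) /\
  forall r : state A, exists p : 'I_n -> R,
    (forall i, 0 <= p i) /\ vec r = \sum_i p i *: vec (s i).

Lemma vec_ge0 A (r : state A) a : 0 <= vec r a.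
Proof. exact: prob_ge0. Qed.

Lemma ConvSt_ge0 A v : ConvSt A v -> forall a, 0 <= v a.
Proof.
move=> [n [x [p [Sx p0 _ ->]]]] a; rewrite sum_scaleE; apply: sumr_ge0 => i _.
by rewrite mulr_ge0 //; have [r _ <-] := Sx i; apply: vec_ge0.
Qed.

(** The null state takes the missing weight. *)
Lemma ConvSt_subconvex A n (s : 'I_n -> state A) (p : 'I_n -> R) :
  (forall i, 0 <= p i) -> \sum_i p i <= 1 ->
  ConvSt A (\sum_i p i *: vec (s i)).
Proof.
move=> p0 p1; have [z z0] := vec_null A.
exists n.+1, (fun i => vec (if unlift ord0 i is Some j then s j else z)),
  (fun i => if unlift ord0 i is Some j then p j else 1 - \sum_j p j); split.
- by move=> i; exists (if unlift ord0 i is Some j then s j else z).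
- by move=> i; case: unlift => [//|]; rewrite subr_ge0.
- rewrite big_ord_recl unlift_none.
  by under [X in _ + X]eq_bigr do rewrite liftK; rewrite subrK.
- rewrite big_ord_recl unlift_none z0 scaler0 add0r.
  by under [RHS]eq_bigr do rewrite liftK.
Qed.

(** Points of [ConvSt] are nonnegative on every effect, so a strict mixture vanishes only if both
    its terms do. *)
Lemma ExtSt_null A : ExtSt A 0.
Proof.
have [z z0] := vec_null A; split.
  by exists 1%N, (fun=> vec z), (fun=> 1); split => //;
    rewrite ?big_ord1 ?z0 ?scaler0 // => _; exists z.
move=> x y t /ConvSt_ge0 x0 /ConvSt_ge0 y0 /andP[t0 t1] e.
have s0 : 0 < 1 - t by rewrite subr_gt0.
suff e' a : x a = 0 /\ y a = 0 by split; apply/funext => a; have [] := e' a.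
have /esym/eqP := congr1 (@^~ a) e; rewrite /= paddr_eq0; last 2 first.
- by rewrite mulr_ge0 // ltW.
- by rewrite mulr_ge0 // ltW.
rewrite !mulf_eq0 (gt_eqF t0) (gt_eqF s0) /=.
by case/andP => /eqP -> /eqP ->.
Qed.

Lemma simplicial_cone_basis A : simplicial Th ->
  exists n (s : 'I_n -> state A), cone_basis s.
Proof.
move=> /(_ A)[x [xE xI xC]].
have [i0 _ x0] : range x 0 by rewrite xE; apply: ExtSt_null.
have /choice[r rE] i : exists r : state A, vec r = x i.
  have [r _ rE] : St A (x i).
    by apply: extreme_conv_hull; rewrite -[extreme_points _]xE; exists i.
  by exists r.
exists (dimSt A), (fun i => r (lift i0 i)); split.
  move=> c ce i.
  (* The vertex [i0] is 0, so its coefficient is free; this choice makes the total 0, as affine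
     independence requires. *)
  pose c' j := if unlift i0 j is Some k then c k else - \sum_k c k.
  have -> : c i = c' (lift i0 i) by rewrite /c' liftK.
  apply: xI; rewrite (bigD1_ord i0) //= /c' unlift_none.
    by under eq_bigr do rewrite liftK; rewrite addNr.
  rewrite x0 scaler0 add0r -[RHS]ce.
  by under eq_bigr do rewrite liftK -rE.
move=> s; have : ConvSt A (vec s).
  by exists 1%N, (fun=> vec s), (fun=> 1); split => //;
    rewrite ?big_ord1 ?scale1r // => _; exists s.
rewrite -xC => -[n [y [p [yx p0 _ ->]]]].
have /choice[f fE] k : exists i, x i = y k by have [i _ <-] := yx k; exists i.
(* The weights of all [y k] at the same vertex are added up; those at the null vertex [i0]
   contribute nothing. *)
exists (fun i => \sum_(k | f k == lift i0 i) p k); split.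
  by move=> i; apply: sumr_ge0.
rewrite (eq_bigr (fun k => p k *: x (f k))) => [|k _]; last by rewrite fE.
rewrite (partition_big f xpredT) //= (bigD1_ord i0) //= big1 ?add0r.
  apply: eq_bigr => i _; rewrite scaler_suml.
  by apply: eq_bigr => k /eqP ->; rewrite rE.
by move=> k /eqP ->; rewrite x0 scaler0.
Qed.

Lemma cone_basis_span A n (s : 'I_n -> state A) v : cone_basis s ->
  StR A v -> exists c : 'I_n -> R, v = \sum_i c i *: vec (s i).
Proof.
move=> [_ sE] [m [x [c [Sx ->]]]].
have /choice[p pE] k : exists p : 'I_n -> R, x k = \sum_i p i *: vec (s i).
  by have [r _ <-] := Sx k; have [p [_ ->]] := sE r; exists p.
exists (fun i => \sum_k c k * p k i).
under [RHS]eq_bigr do rewrite scaler_suml; rewrite [RHS]exchange_big.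
apply: eq_bigr => k _; rewrite pE scaler_sumr.
by apply: eq_bigr => i _; rewrite scalerA.
Qed.

Lemma ConvSt_StR A : ConvSt A `<=` StR A.
Proof. by move=> v [n [x [p [Sx _ _ ->]]]]; exists n, x, p. Qed.

(* The positive and negative parts of a linear relation, scaled down by M and
   completed with the null state, are two points of ConvSt. *)
Lemma locally_discriminable_lin_indep A B n (s : 'I_n -> state (A ** B)) :
  local_discriminability Th -> lin_indep (fun i => vec (s i)) ->
  lin_indep (fun i (e : effect A * effect B) =>
    vec (s i) (prod_effect e.1 e.2) : R^o).
Proof.
move=> LD sI; apply/lin_indepP => c ce.
(* The summand 1 keeps [M] positive even if [c] is zero. The parts [p] and [q] of [c / M] then each
   have total at most 1. *)
pose M := 1 + \sum_i `|c i|.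
have M0 : 0 < M by rewrite ltr_pwDl ?ltr01 // sumr_ge0.
pose p i := (`|c i| + c i) / (2 * M); pose q i := (`|c i| - c i) / (2 * M).
have M2 : 0 < 2 * M by rewrite mulr_gt0.
have absM i : `|c i| + `|c i| = 2 * `|c i| by rewrite mulr_natl mulr2n.
have le1 (d : 'I_n -> R) : (forall i, d i <= `|c i|) ->
    \sum_i (`|c i| + d i) / (2 * M) <= 1.
  move=> dc; rewrite -mulr_suml ler_pdivrMr // mul1r.
  rewrite mulrDr mulr1 mulr_sumr -[leLHS]add0r lerD //.
  by apply: ler_sum => i _; rewrite -absM lerD2l.
have pq i : p i - q i = c i / M.
  rewrite /p /q -mulrBl opprB -addrA addrC -addrA subrK.
  rewrite -mulr2n -[c i *+ 2]mulr_natl.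
  by rewrite invfM mulrACA divff ?mul1r // pnatr_eq0.
have e : \sum_i p i *: vec (s i) = \sum_i q i *: vec (s i).
  apply: (LD A [:: B]).
  - apply: ConvSt_subconvex; last by apply: le1 => i; apply: ler_norm.
    move=> i; rewrite divr_ge0 ?(ltW M2) //.
    by rewrite -[c i in X in _ + X]opprK subr_ge0 -normrN ler_norm.
  - apply: ConvSt_subconvex; last first.
      by apply: le1 => i; rewrite -normrN ler_norm.
    by move=> i; rewrite divr_ge0 ?(ltW M2) // subr_ge0 ler_norm.
  move=> m f d fP _; apply: eq_bigr => k _; congr (_ * _).
  have [a [b [_ ->]]] := fP k; apply/eqP; rewrite -subr_eq0 !sum_scaleE -sumrB.
  apply/eqP; transitivity (M^-1 * \sum_i c i * vec (s i) (prod_effect a b)).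
    rewrite mulr_sumr; apply: eq_bigr => i _.
    by rewrite -mulrBl pq [RHS]mulrA [M^-1 * _]mulrC.
  by rewrite (ce (a, b)) mulr0.
move=> i; have : p i - q i = 0.
  apply: (sI (fun i => p i - q i)).
  by under eq_bigr do rewrite scalerBl; rewrite sumrB e subrr.
by rewrite pq => /eqP; rewrite mulf_eq0 invr_eq0 (gt_eqF M0) orbF => /eqP.
Qed.

(** * From separable states to local discriminability *)

Lemma prod_state_sum A B n m (r : 'I_n -> state A) (s : 'I_m -> state B)
    (p : 'I_n -> R) (q : 'I_m -> R) a b e :
  vec a = \sum_i p i *: vec (r i) -> vec b = \sum_j q j *: vec (s j) ->
  vec (prod_state a b) e =
  \sum_i \sum_j p i * q j * vec (prod_state (r i) (s j)) e.
Proof.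
(* Inserting one factor into [e] leaves an effect on the other factor, on which the given expansion
   can be evaluated. *)
move=> aE bE; rewrite exchange_big -vec_insert_left bE sum_scaleE.
apply: eq_bigr => j _.
rewrite vec_insert_left -vec_insert_right aE sum_scaleE mulr_sumr.
by apply: eq_bigr => i _; rewrite vec_insert_right mulrCA mulrA.
Qed.

(** Induction on the factors, splitting the first from the rest. The signed coefficients [c] let the
    induction hypothesis apply to arbitrary linear combinations of the [y j]. *)
Lemma separable_product_effects A (s : seq (sys Th)) :
  simplicial Th -> (forall A B (r : state (A ** B)), separable r) ->
  forall n (r : 'I_n -> state (multipartite A s)) (c : 'I_n -> R),
  (forall e, product_effects e -> \sum_i c i * vec (r i) e = 0) ->
  forall e, \sum_i c i * vec (r i) e = 0.
Proof.
move=> simpl sep; elim: s A => [|B s IH] A n r c ce.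
  by move=> e; apply: ce.
have [n1 [x [xI xE]]] := simplicial_cone_basis A simpl.
have [n2 [y [yI yE]]] := simplicial_cone_basis (multipartite B s) simpl.
have /choice[t tE] h : exists t : 'I_n1 -> 'I_n2 -> R, forall e,
    vec (r h) e = \sum_i \sum_j t i j * vec (prod_state (x i) (y j)) e.
  have [k [p [a [b [_ _ _ ->]]]]] := sep _ _ (r h).
  have /choice[u uE] l := xE (a l); have /choice[v vE] l := yE (b l).
  exists (fun i j => \sum_l p l * (u l i * v l j)) => e; rewrite sum_scaleE.
  under eq_bigr => l _.
    rewrite (prod_state_sum e (uE l).2 (vE l).2) mulr_sumr.
    under eq_bigr do rewrite mulr_sumr.
    over.
  rewrite exchange_big; apply: eq_bigr => i _.
  rewrite exchange_big; apply: eq_bigr => j _.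
  by rewrite mulr_suml; apply: eq_bigr => l _; rewrite mulrA.
pose C i j := \sum_h c h * t h i j.
have CE e : \sum_h c h * vec (r h) e =
    \sum_i \sum_j C i j * vec (prod_state (x i) (y j)) e.
  under eq_bigr => h _.
    rewrite tE mulr_sumr.
    under eq_bigr do rewrite mulr_sumr.
    over.
  rewrite exchange_big; apply: eq_bigr => i _.
  rewrite exchange_big; apply: eq_bigr => j _.
  by rewrite mulr_suml; apply: eq_bigr => l _; rewrite mulrA.
have C0 i j : C i j = 0.
  (* Independence of [y] and the induction hypothesis reduce to product effects [b] on the rest; for
     each such [b], independence of [x] removes the first factor. *)
  move: j; apply: ((lin_indepP _).1 yI); apply: IH => b bP; move: i.
  apply: ((lin_indepP _).1 xI (fun i => \sum_j C i j * vec (y j) b)) => a.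
  rewrite -[RHS](ce (prod_effect a b)); last by exists a, b.
  rewrite CE; apply: eq_bigr => i _; rewrite mulr_suml; apply: eq_bigr => j _.
  by rewrite vec_prod_state -mulrA [vec (y j) b * _]mulrC.
move=> e; rewrite CE big1 // => i _; rewrite big1 // => j _.
by rewrite C0 mul0r.
Qed.

Lemma separable_local_discriminability :
  simplicial Th -> (forall A B (r : state (A ** B)), separable r) ->
  local_discriminability Th.
Proof.
move=> simpl sep A s x y Cx Cy xy.
have [n [r rB]] := simplicial_cone_basis (multipartite A s) simpl.
have [c cE] := cone_basis_span rB (ConvSt_StR Cx).
have [d dE] := cone_basis_span rB (ConvSt_StR Cy).
have cdE e : \sum_i (c i - d i) * vec (r i) e = x e - y e.
  rewrite cE dE !sum_scaleE -sumrB.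
  by apply: eq_bigr => i _; rewrite mulrBl.
apply/funext => e; apply/eqP; rewrite -subr_eq0 -cdE; apply/eqP; move: e.
apply: separable_product_effects => // e eP; apply/eqP.
rewrite cdE subr_eq0; apply/eqP.
have := xy 1%N (fun=> e) (fun=> 1) (fun=> eP) (fun=> ler01).
by rewrite !big_ord1 !mul1r.
Qed.

(** * From local discriminability to separable states *)

(* Contracting the decomposition PE with an effect of B (resp. A) leaves a
   multiple of x i (resp. y j), and extremality puts the contraction of z h on
   the same ray. *)
Lemma cone_basis_prod_ray A B n m k (x : 'I_n -> state A) (y : 'I_m -> state B)
    (z : 'I_k -> state (A ** B)) (P : 'I_k -> R) i j h :
  local_discriminability Th -> cone_basis x -> cone_basis y -> cone_basis z ->
  (forall l, 0 <= P l) ->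
  vec (prod_state (x i) (y j)) = \sum_l P l *: vec (z l) -> 0 < P h ->
  exists c, 0 < c /\ vec (z h) = c *: vec (prod_state (x i) (y j)).
Proof.
move=> LD [xI xE] [yI yE] [zI _] P0 PE Ph.
have PEab a b : \sum_l P l * vec (z l) (prod_effect a b) =
    vec (x i) a * vec (y j) b by rewrite -vec_prod_state PE sum_scaleE.
have xray b : exists u, forall a, vec (z h) (prod_effect a b) = u * vec (x i) a.
  have /choice[u uE] l := xE (contract_right b (z l)).
  exists (u h i) => a; rewrite -vec_contract_right.
  apply: (lin_indep_ray (g := fun l => vec (contract_right b (z l)))
    (P := P) (z := vec (y j) b) xI) => // [l t|l|t].
  - by rewrite (uE l).2 sum_scaleE.
  - exact: (uE l).1.
  rewrite mulrC -PEab; apply: eq_bigr => l _.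
  by rewrite vec_contract_right.
have yray a : exists w, 0 <= w /\
    forall b, vec (z h) (prod_effect a b) = w * vec (y j) b.
  have /choice[w wE] l := yE (contract_left a (z l)).
  exists (w h j); split=> [|b]; first exact: (wE h).1.
  rewrite -vec_contract_left.
  apply: (lin_indep_ray (g := fun l => vec (contract_left a (z l)))
    (P := P) (z := vec (x i) a) yI) => // [l t|l|t].
  - by rewrite (wE l).2 sum_scaleE.
  - exact: (wE l).1.
  by rewrite -PEab; apply: eq_bigr => l _; rewrite vec_contract_left.
have [a0 xa0] := lin_indep_neq0 i xI.
have [w [w0 wE]] := yray a0.
(* Evaluating both ray descriptions of [z h] at [a0] gives [u = w * vec (y j) b / vec (x i) a0], so
   [c] is the ratio of [z h] to the product on product effects. *)
pose c := w / vec (x i) a0.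
(* Proportionality on product effects becomes equality of coordinates over [z], hence
   proportionality on all effects. *)
have cP : forall l, (l == h)%:R = c * P l.
  apply: (lin_indep_eq (locally_discriminable_lin_indep LD zI)) => -[a b] /=.
  under [RHS]eq_bigr do rewrite -mulrA.
  rewrite -mulr_sumr PEab (bigD1 h) //= eqxx mul1r big1 ?addr0; last first.
    by move=> l /negbTE ->; rewrite mul0r.
  have [u uE] := xray b; rewrite uE /c.
  have := wE b; rewrite uE => /(canRL (mulfK xa0)) ->.
  rewrite -!mulrA; congr (w * _).
  by rewrite mulrCA; congr (_ * _); rewrite mulrC.
exists c; split.
  rewrite lt_neqAle divr_ge0 ?vec_ge0 // andbT eq_sym.
  by apply/eqP => c0; have /eqP := cP h; rewrite c0 mul0r eqxx oner_eq0.
rewrite PE scaler_sumr; under eq_bigr do rewrite scalerA -cP.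
rewrite (bigD1 h) //= eqxx scale1r big1 ?addr0 // => l /negbTE ->.
by rewrite scale0r.
Qed.

Lemma cone_basis_prod_span A B n m (x : 'I_n -> state A) (y : 'I_m -> state B)
    (r : state (A ** B)) : cone_basis x -> cone_basis y ->
  exists t : 'I_n -> 'I_m -> R, forall a b, vec r (prod_effect a b) =
    \sum_i \sum_j t i j * (vec (x i) a * vec (y j) b).
Proof.
move=> [xI xE] [_ yE]; have [T [d dE]] := lin_indep_dual xI.
have /choice[u uE] b := xE (contract_right b r).
have /choice[w wE] a := yE (contract_left a r).
have uab a b : vec r (prod_effect a b) = \sum_i u b i * vec (x i) a.
  by rewrite -vec_contract_right (uE b).2 sum_scaleE.
have wab a b : vec r (prod_effect a b) = \sum_j w a j * vec (y j) b.
  by rewrite -vec_contract_left (wE a).2 sum_scaleE.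
exists (fun i j => \sum_l d i l * w (T l) j) => a b; rewrite uab.
apply: eq_bigr => i _.
(* How [u b i] depends on [b] is not known a priori. The functional dual to [x i] rewrites it
   through effects [T l], and each resulting term expands over [y]. *)
have -> : u b i = \sum_l d i l * vec r (prod_effect (T l) b).
  transitivity (\sum_h u b h * (i == h)%:R).
    rewrite (bigD1 i) //= eqxx mulr1 big1 ?addr0 // => h.
    by rewrite eq_sym => /negbTE ->; rewrite mulr0.
  under [RHS]eq_bigr do rewrite uab mulr_sumr.
  rewrite [RHS]exchange_big; apply: eq_bigr => h _.
  by rewrite -dE mulr_sumr; apply: eq_bigr => l _; rewrite mulrCA.
under eq_bigr do rewrite wab mulr_sumr.
rewrite exchange_big mulr_suml; apply: eq_bigr => j _.
rewrite !mulr_suml; apply: eq_bigr => l _.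
by rewrite -!mulrA [vec (x i) a * _]mulrC.
Qed.

Lemma local_discriminability_separable A B (r : state (A ** B)) :
  simplicial Th -> local_discriminability Th -> separable r.
Proof.
move=> simpl LD.
have [n [x xB]] := simplicial_cone_basis A simpl.
have [m [y yB]] := simplicial_cone_basis B simpl.
have [k [z zB]] := simplicial_cone_basis (A ** B) simpl.
have /choice[P PE] (ij : 'I_n * 'I_m) := zB.2 (prod_state (x ij.1) (y ij.2)).
have [q [q0 qE]] := zB.2 r.
have [t tE] := cone_basis_prod_span r xB yB.
have qP h : q h = \sum_i \sum_j t i j * P (i, j) h.
  move: h; apply: (lin_indep_eq (locally_discriminable_lin_indep LD zB.1)).
  move=> -[a b] /=; transitivity (vec r (prod_effect a b)).
    by rewrite qE sum_scaleE.
  rewrite tE.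
  under [RHS]eq_bigr do rewrite mulr_suml; rewrite [RHS]exchange_big.
  apply: eq_bigr => i _.
  under [RHS]eq_bigr do rewrite mulr_suml; rewrite [RHS]exchange_big.
  apply: eq_bigr => j _.
  rewrite -vec_prod_state (PE (i, j)).2 sum_scaleE mulr_sumr.
  by apply: eq_bigr => h _; rewrite mulrA.
(* Separability asks for positive weights, so only the indices with [q h] positive are enumerated.
   By [qP], each occurs in some product [(i, j)]. *)
have /choice[f fE] (l : 'I_#|[pred h | 0 < q h]|) :
    exists v : R * ('I_n * 'I_m), 0 < v.1 /\
    vec (z (enum_val l)) = v.1 *: vec (prod_state (x v.2.1) (y v.2.2)).
  have ql : 0 < q (enum_val l) by have := enum_valP l.
  have [i [j Pij]] : exists i j, P (i, j) (enum_val l) != 0.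
    apply: contrapT => no; move: ql; rewrite qP big1 ?ltxx // => i _.
    rewrite big1 // => j _.
    suff -> : P (i, j) (enum_val l) = 0 by rewrite mulr0.
    by apply: contrapT => /eqP ne; apply: no; exists i, j.
  have Pij_gt0 : 0 < P (i, j) (enum_val l).
    by rewrite lt_neqAle eq_sym Pij (PE (i, j)).1.
  have [c [c0 cE]] :=
    cone_basis_prod_ray LD xB yB zB (PE (i, j)).1 (PE (i, j)).2 Pij_gt0.
  by exists (c, (i, j)).
have nz C n' (s : 'I_n' -> state C) i : cone_basis s -> vec (s i) <> 0.
  by move=> [/(lin_indep_neq0 i)[a sa] _] s0; move: sa; rewrite s0 eqxx.
exists #|[pred h | 0 < q h]|, (fun l => q (enum_val l) * (f l).1),
  (fun l => x (f l).2.1), (fun l => y (f l).2.2); split.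
- by move=> l; rewrite mulr_gt0 ?(fE l).1 //; have := enum_valP l.
- by move=> l; apply: nz.
- by move=> l; apply: nz.
rewrite qE (bigID [pred h | 0 < q h]) /= addrC big1 ?add0r => [|h]; last first.
  by rewrite lt_neqAle q0 andbT negbK => /eqP <-; rewrite scale0r.
rewrite (eq_bigl (mem [pred h | 0 < q h])) // big_enum_val.
by apply: eq_bigr => l _; rewrite (fE l).2 scalerA.
Qed.

End ConeBases.

Theorem theorem2 (R : realType) (Theta : opt R) (hsimp : simplicial Theta) :
  admits_entangled_states Theta <-> ~ local_discriminability Theta.
Proof.
split=> [[A [B [r rE]]] LD|nLD].
  exact: rE (local_discriminability_separable r hsimp LD).
apply: contrapT => no; apply: nLD.
apply: separable_local_discriminability => //.
by move=> A B r; apply: contrapT => rE; apply: no; exists A, B, r.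
Qed.
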